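(* Let $\gamma$ be a nonconvex standard polygonal escape minimizer with selected gap $FT$, upward contact $M$, and marked contacts as described in the context. Assume a genuine right failure and no genuine left failure, so that after resolving coincident labels at one temporal vertex, $$F\prec M\prec T\prec Z_1,\qquad F\prec Z_2\prec T,$$ and let the right delimiter gap $UV$ satisfy $F\prec U\prec T\prec V$. Then for every value $t_R\in[-t_*,t_*]$ of the delimiter parameter and every compatible weak deque order of the marked contacts, $$\operatorname{len}(\gamma)\ge R>D,\qquad R=\frac{96717}{100000},\quad D=\frac{82074390584}{84861020075}.$$
   Context: Put $p=766$, $q=197$, $S=p^2+q^2=625565$, $s=p/\sqrt S$, $c=q/\sqrt S$, $\beta=\arctan(p/q)$, $\eta=\frac\pi2-\beta$, $\rho=2sc=\frac{301804}{625565}$, $\kappa=s^2-c^2=\frac{547947}{625565}$, $\chi=2c^2=\frac{77618}{625565}$, $t_*=\tan\frac\eta2$, $u_\phi=(\cos\phi,\sin\phi)$. Let $\mathcal K=\operatorname{conv}\{(-c,0),(c,0),(0,s)\}$. A path is an escape path if no translated and rotated copy of it lies in the interior of $\mathcal K$. A polygonal path is standard if it is simple and its nonrepeated vertices are exactly the extreme vertices of its convex hull, each visited once; a hull edge not traversed by the path is a gap; a standard path is convex if its links follow one hull-boundary chain between its endpoints, nonconvex otherwise. $X\prec Y$ means $X$ is visited strictly before $Y$. Setting: $\gamma$ is a nonconvex standard polygonal escape path, length-minimal among polygonal escape paths with at most $N$ segments for some $N$. Its selected gap is a gap $FT$ with a hull vertex $M$ and $h>0$ such that, in suitable rigid coordinates,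 the hull $H=\operatorname{conv}\gamma$ lies in $0\le y\le h$ (both lines supporting it), $F=(x_F,0)$, $T=(x_T,0)$, $M=(x_M,h)$, $x_F\le x_T$, $F\prec M\prec T$, and $\operatorname{len}(\gamma)\ge(1+\sqrt2)h$. A right delimiter gap is a gap $UV$ with $U,V$ adjacent hull vertices, $U$ before $V$ on the clockwise boundary arc of $H$ from $M$ to $Z_1$. Its outward unit normal is $n_R=u_{\beta+\theta_R}$ with $-\eta\le\theta_R\le\eta$, and $t_R:=\tan(\theta_R/2)$. Marked contacts: a contact of a direction $v$ is a vertex of $H$ maximizing $x\cdot v$ over $H$, and the label of a direction also denotes its chosen contact. With $C_R=\frac{1-t_R^2}{1+t_R^2}$, $S_R=\frac{2t_R}{1+t_R^2}$, the directions are: $Z_1=(\rho,\kappa)$, $Z_2=(-\rho,\kappa)$, $P_2=2c(s,c)$, $Q_3=2c(-s,c)$, $E_1=(\rho,-\chi)$, $E_2=(-\rho,-\kappa)$, $E_3=(-\rho,-\chi)$, $E_4=(\rho,-\kappa)$, $(0,1)$ with contact $M$, $(0,-1)$ with contacts $F,T$, $n_R$ with contacts $U,V$, $A_R=\frac{1}{\sqrt S}(-2qC_R,-2qS_R)$, and $B_R=\frac1{\sqrt S}(qC_R+pS_R,\,qS_R-pC_R)$. The contacts are chosen weakly monotone along the clockwise boundary from $F$ to $T$ in the fan order $$F,E_2,E_3,A_R,Q_3,Z_2,M,U,V,Z_1,P_2,E_1,E_4,B_R,T.$$ A compatible weak deque order is a temporal order of these labels along $\gamma$ (labels at the same vertex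 may be tied, and ties may be resolved in either order) that satisfies the stated incidences and in which, at every stage, the not-yet-visited labels form an interval in the cyclic fan order. A genuine right failure means that $T\prec Z_1$ at distinct vertices; a genuine left failure means that $Z_2\prec F$ at distinct vertices. *)

(* Defs.v *)
From Stdlib Require Import Reals Lra List Permutation Lia.
From Coquelicot Require Import Coquelicot.
Import ListNotations.
Local Open Scope R_scope.

(** * Numerical data *)

Definition pp : R := 766.
Definition qq : R := 197.
Definition SS : R := pp ^ 2 + qq ^ 2.
Definition sb : R := pp / sqrt SS.
Definition cb : R := qq / sqrt SS.
Definition beta : R := atan (pp / qq).
Definition eta : R := PI / 2 - beta.
Definition rho : R := 2 * sb * cb.
Definition kappa : R := sb ^ 2 - cb ^ 2.
Definition chi : R := 2 * cb ^ 2.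
Definition tstar : R := tan (eta / 2).
Definition Rbound : R := 96717 / 100000.
Definition Dbound : R := 82074390584 / 84861020075.

Lemma sqrt_SS2 : sqrt SS * sqrt SS = 625565.
Proof. rewrite sqrt_sqrt; unfold SS, pp, qq; lra. Qed.

Lemma sqrt_SS_neq0 : sqrt SS <> 0.
Proof. intro H; pose proof sqrt_SS2 as K; rewrite H in K; lra. Qed.

Lemma rhoE : rho = 301804 / 625565.
Proof.
unfold rho, sb, cb; rewrite <- sqrt_SS2; unfold pp, qq.
field; exact sqrt_SS_neq0.
Qed.

Lemma kappaE : kappa = 547947 / 625565.
Proof.
unfold kappa, sb, cb; rewrite <- sqrt_SS2; unfold pp, qq.
field; exact sqrt_SS_neq0.
Qed.

Lemma chiE : chi = 77618 / 625565.
Proof.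
unfold chi, sb, cb; rewrite <- sqrt_SS2; unfold pp, qq.
field; exact sqrt_SS_neq0.
Qed.

(** * Plane geometry *)

Definition pt : Type := (R * R)%type.

Definition dist (a b : pt) : R := dist_euc (fst a) (snd a) (fst b) (snd b).
Definition dot (a b : pt) : R := fst a * fst b + snd a * snd b.
Definition uvec (phi : R) : pt := (cos phi, sin phi).
Definition scale (k : R) (a : pt) : pt := (k * fst a, k * snd a).

(* The point (1-t) a + t b. *)
Definition between (t : R) (a b : pt) : pt :=
  ((1 - t) * fst a + t * fst b, (1 - t) * snd a + t * snd b).

(* Negative exactly when a, b, c is a clockwise triangle. *)
Definition orient (a b c : pt) : R :=
  (fst b - fst a) * (snd c - snd a) - (snd b - snd a) * (fst c - fst a).

Definition segment (a b x : pt) : Prop :=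
  exists t, 0 <= t <= 1 /\ x = between t a b.

Definition convex_set (A : pt -> Prop) : Prop :=
  forall a b t, A a -> A b -> 0 <= t <= 1 -> A (between t a b).

Definition conv (A : pt -> Prop) (x : pt) : Prop :=
  forall B : pt -> Prop, convex_set B -> (forall y, A y -> B y) -> B x.

Definition extreme (A : pt -> Prop) (x : pt) : Prop :=
  A x /\
  forall a b t, A a -> A b -> 0 < t < 1 -> x = between t a b -> a = x /\ b = x.

Definition interior (A : pt -> Prop) (x : pt) : Prop := locally x A.

(* Rotation by phi followed by translation by v if e = 1; the same preceded by
   the reflection in the x-axis if e = -1. *)
Definition motion (e phi : R) (v x : pt) : pt :=
  (fst v + cos phi * fst x - sin phi * (e * snd x),
   snd v + sin phi * fst x + cos phi * (e * snd x)).

Definition rigid (g : pt -> pt) : Prop :=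
  exists e phi v, (e = 1 \/ e = -1) /\ forall x, g x = motion e phi v x.

Definition triangle : pt -> Prop :=
  conv (fun x => In x [(- cb, 0); (cb, 0); (0, sb)]).

(** * Positions in lists *)

(* Both relations are meant for lists without repetition. *)
Definition before {A : Type} (l : list A) (a b : A) : Prop :=
  exists i j, (i < j)%nat /\ nth_error l i = Some a /\ nth_error l j = Some b.

Definition weakly_before {A : Type} (l : list A) (a b : A) : Prop :=
  exists i j, (i <= j)%nat /\ nth_error l i = Some a /\ nth_error l j = Some b.

(** * Polygonal paths *)

(* A polygonal path is the list of its vertices in temporal order, so that
   [before gam X Y] is the relation "X is visited strictly before Y". *)
Definition path : Type := list pt.

Definition segments (gam : path) : nat := pred (length gam).

Definition is_link (gam : path) (i : nat) (a b : pt) : Prop :=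
  nth_error gam i = Some a /\ nth_error gam (S i) = Some b.

Fixpoint len (gam : path) : R :=
  match gam with
  | a :: ((b :: _) as gam') => dist a b + len gam'
  | _ => 0
  end.

Definition trace (gam : path) (x : pt) : Prop :=
  exists i a b, is_link gam i a b /\ segment a b x.

Definition hull (gam : path) : pt -> Prop := conv (trace gam).

Definition hull_vertex (gam : path) (x : pt) : Prop := extreme (hull gam) x.

Definition escape (gam : path) : Prop :=
  forall phi v,
    ~ (forall x, trace gam x -> interior triangle (motion 1 phi v x)).

Definition escape_minimizer (N : nat) (gam : path) : Prop :=
  escape gam /\ (segments gam <= N)%nat /\
  forall gam', escape gam' -> (segments gam' <= N)%nat -> len gam <= len gam'.

Definition simple (gam : path) : Prop :=
  NoDup gam /\
  forall i j a b c d x, (i < j)%nat ->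
    is_link gam i a b -> is_link gam j c d ->
    segment a b x -> segment c d x -> j = S i /\ x = c.

Definition standard (gam : path) : Prop :=
  simple gam /\ forall x, In x gam <-> hull_vertex gam x.

(* Two distinct hull vertices on a common supporting line of the hull, that is,
   two adjacent vertices of the hull polygon. *)
Definition hull_edge (gam : path) (a b : pt) : Prop :=
  hull_vertex gam a /\ hull_vertex gam b /\ a <> b /\
  exists n : pt, n <> (0, 0) /\ dot a n = dot b n /\
    forall x, hull gam x -> dot x n <= dot a n.

Definition traversed (gam : path) (a b : pt) : Prop :=
  exists i, is_link gam i a b \/ is_link gam i b a.

Definition gap (gam : path) (a b : pt) : Prop :=
  hull_edge gam a b /\ ~ traversed gam a b.

(* A standard path visits no vertex twice, so when all its links are hull edges
   they never turn back and follow one boundary chain. *)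
Definition convex_path (gam : path) : Prop :=
  forall i a b, is_link gam i a b -> hull_edge gam a b.

(* [w] lists the hull vertices clockwise, starting at F and ending at T. *)
Definition clockwise_boundary (gam : path) (F T : pt) (w : list pt) : Prop :=
  NoDup w /\ (forall x, In x w <-> hull_vertex gam x) /\
  (exists w', w = F :: w' ++ [T]) /\
  forall i j k a b c, (i < j)%nat -> (j < k)%nat ->
    nth_error w i = Some a -> nth_error w j = Some b ->
    nth_error w k = Some c -> orient a b c < 0.

(** * The selected gap and the right delimiter gap *)

(* Here [gam] is already expressed in the adapted rigid coordinates. *)
Definition selected_gap (gam : path) (F M T : pt) (h : R) : Prop :=
  gap gam F T /\ hull_vertex gam M /\ 0 < h /\
  (forall x, hull gam x -> 0 <= snd x <= h) /\
  snd F = 0 /\ snd T = 0 /\ snd M = h /\ fst F <= fst T /\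
  before gam F M /\ before gam M T /\
  len gam >= (1 + sqrt 2) * h.

Definition outward_unit_normal (gam : path) (a b n : pt) : Prop :=
  dot n n = 1 /\ dot a n = dot b n /\
  forall x, hull gam x -> dot x n <= dot a n.

Definition normR (thetaR : R) : pt := uvec (beta + thetaR).

(* [w] is the clockwise boundary of the hull, which contains the arc from M to
   Z1. *)
Definition right_delimiter_gap
    (gam : path) (w : list pt) (M Z1 U V : pt) (thetaR : R) : Prop :=
  gap gam U V /\
  weakly_before w M U /\ before w U V /\ weakly_before w V Z1 /\
  outward_unit_normal gam U V (normR thetaR) /\
  - eta <= thetaR <= eta.

(** * Marked contacts *)

Inductive label : Type :=
  | LF | LE2 | LE3 | LA | LQ3 | LZ2 | LM | LU | LV
  | LZ1 | LP2 | LE1 | LE4 | LB | LT.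

Definition fan : list label :=
  [LF; LE2; LE3; LA; LQ3; LZ2; LM; LU; LV; LZ1; LP2; LE1; LE4; LB; LT].

Definition CR (tR : R) : R := (1 - tR ^ 2) / (1 + tR ^ 2).
Definition SR (tR : R) : R := 2 * tR / (1 + tR ^ 2).

Definition direction (thetaR tR : R) (l : label) : pt :=
  match l with
  | LF | LT => (0, -1)
  | LM => (0, 1)
  | LU | LV => normR thetaR
  | LZ1 => (rho, kappa)
  | LZ2 => (- rho, kappa)
  | LP2 => scale (2 * cb) (sb, cb)
  | LQ3 => scale (2 * cb) (- sb, cb)
  | LE1 => (rho, - chi)
  | LE2 => (- rho, - kappa)
  | LE3 => (- rho, - chi)
  | LE4 => (rho, - kappa)
  | LA => scale (1 / sqrt SS) (- 2 * qq * CR tR, - 2 * qq * SR tR)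
  | LB => scale (1 / sqrt SS)
            (qq * CR tR + pp * SR tR, qq * SR tR - pp * CR tR)
  end.

Definition contact (gam : path) (v x : pt) : Prop :=
  hull_vertex gam x /\ forall y, hull gam y -> dot y v <= dot x v.

Definition marked_contacts
    (gam : path) (w : list pt) (thetaR tR : R) (mk : label -> pt) : Prop :=
  (forall l, contact gam (direction thetaR tR l) (mk l)) /\
  ForallOrdPairs (fun l l' => weakly_before w (mk l) (mk l')) fan.

Definition genuine_right_failure (gam : path) (mk : label -> pt) : Prop :=
  mk LT <> mk LZ1 /\ before gam (mk LT) (mk LZ1).

Definition genuine_left_failure (gam : path) (mk : label -> pt) : Prop :=
  mk LZ2 <> mk LF /\ before gam (mk LZ2) (mk LF).

(** * Weak deque orders *)

Definition fan_interval (ls : list label) : Prop :=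
  exists r m, Permutation ls (firstn m (skipn r fan ++ firstn r fan)).

(* The precedences are imposed on the labels, after ties have been resolved: for
   instance Z2 and F may share a vertex, and then F is listed first. *)
Definition stated_incidences (ord : list label) : Prop :=
  before ord LF LM /\ before ord LM LT /\ before ord LT LZ1 /\
  before ord LF LZ2 /\ before ord LZ2 LT /\
  before ord LF LU /\ before ord LU LT /\ before ord LT LV.

(* [ord] lists the labels by time of visit along [gam]; labels sharing a vertex
   may be listed in either order. *)
Definition compatible_weak_deque_order
    (gam : path) (mk : label -> pt) (ord : list label) : Prop :=
  Permutation fan ord /\
  ForallOrdPairs (fun l l' => weakly_before gam (mk l) (mk l')) ord /\
  stated_incidences ord /\
  forall k, fan_interval (skipn k ord).

(* Main.v *)
From Stdlib Require Import Reals Lra Lia List Permutation ZArith Sorted.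
From Coquelicot Require Import Coquelicot.
Require Import Defs.
Import ListNotations.
Local Open Scope R_scope.

(** The proof is linear programming duality.

    A path that fits strictly inside no copy of the triangle satisfies, for every
    orientation of the triangle, a support inequality: if the base has outward
    unit normal [e] and the legs have outward unit normals [l1] and [l2], then
    [2c H(e) + H(l1) + H(l2) >= rho], where [H] is the support function of the
    path ([escape_support_rigid]). The orientations whose base normals are along
    [Q3], [P2] and [A] have these normals among the marked directions, and the
    three inequalities read
    [Z1 + F + Q3 >= rho], [Z2 + F + P2 >= rho] and [n_R + A + B >= rho], each
    direction standing for its support value ([marked_support_inequalities]).
    Here [F] contributes zero, being at height zero.

    Conversely, let forces that add up to zero act on some points of the path. If
    the partial sums of the forces in temporal order have norm at most one, then
    the length is at least the sum of the dot products of forces and points: a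
    link is at least as long as its component against the partial sum of the
    forces before it ([taut_le_len]). Take as forces the normals of the three
    inequalities with nonnegative multipliers [a3], [a4], [b], balance them by
    vertical forces at [F] and [T], which do no work at height zero, and share the
    force [b n_R] between [U] and [V], which have the same support value. The sum
    is then at least [(a3 + a4 + b) rho] ([total_work_ge]), and it remains to find
    multipliers with [(a3 + a4 + b) rho >= R] whose partial sums are short.

    Which partial sums occur depends on the order of the labels. The visited
    labels always form an arc of the fan, and together with the given precedences
    this leaves few possibilities for the ten labels that carry a force
    ([deque_orders]). If [B] precedes [V], then [a3 = 0] works; the best value of
    [(a4 + b) rho] is smallest near the end [t = t_*] of the range, where it is
    about 0.967173, barely above [R], and the multipliers are linear functions of
    [t] that follow the best ones closely there. If [V] precedes [B], then
    constants are enough, up to the common factor [(1 + t ^ 2) sqrt S] which makes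
    the turning directions polynomial in [t]. In both cases the conditions on the
    norms say that certain explicit polynomials are nonnegative on the range of
    [t], which is decided exactly by integer arithmetic ([pnonneg_correct],
    [orders_taut]). *)

(** * Integer polynomials and their positivity on an interval *)

Definition poly : Type := list Z.

Fixpoint peval (p : poly) (x : R) : R :=
  match p with
  | [] => 0
  | c :: p' => IZR c + x * peval p' x
  end.

Fixpoint padd (p r : poly) : poly :=
  match p, r with
  | [], _ => r
  | _, [] => p
  | a :: p', b :: r' => (a + b)%Z :: padd p' r'
  end.

Definition pscale (k : Z) (p : poly) : poly := map (Z.mul k) p.

Fixpoint pmul (p r : poly) : poly :=
  match p with
  | [] => []
  | a :: p' => padd (pscale a r) (0%Z :: pmul p' r)
  end.

Fixpoint pshift (h : Z) (p : poly) : poly :=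
  match p with
  | [] => []
  | c :: p' => let s := pshift h p' in padd [c] (padd (pscale h s) (0%Z :: s))
  end.

Lemma peval_add (p r : poly) (x : R) :
  peval (padd p r) x = peval p x + peval r x.
Proof.
revert r; induction p as [|a p IH]; intros [|b r]; cbn [padd peval]; try ring.
rewrite plus_IZR, IH; ring.
Qed.

Lemma peval_scale (k : Z) (p : poly) (x : R) :
  peval (pscale k p) x = IZR k * peval p x.
Proof.
induction p as [|a p IH]; cbn [pscale map peval]; [ring|].
rewrite mult_IZR; fold (pscale k p); rewrite IH; ring.
Qed.

Lemma peval_mul (p r : poly) (x : R) :
  peval (pmul p r) x = peval p x * peval r x.
Proof.
induction p as [|a p IH]; cbn [pmul peval]; [ring|].
rewrite peval_add, peval_scale; cbn [peval]; rewrite IH; ring.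
Qed.

Lemma peval_shift (h : Z) (p : poly) (x : R) :
  peval (pshift h p) x = peval p (x + IZR h).
Proof.
induction p as [|c p IH]; cbn [pshift peval]; [reflexivity|].
rewrite !peval_add, peval_scale; cbn [peval]; rewrite IH; ring.
Qed.

(** Interval arithmetic in Horner form: a negative lower bound of the tail is
    worst at the right end of [[0, w]], a nonnegative one at the left end. *)
Fixpoint plower (w : Z) (p : poly) : Z :=
  match p with
  | [] => 0
  | c :: p' => c + Z.min 0 (w * plower w p')
  end%Z.

Lemma plower_le (w : Z) (p : poly) (x : R) :
  0 <= x <= IZR w -> IZR (plower w p) <= peval p x.
Proof.
intros Hx; induction p as [|c p IH]; cbn [plower peval]; [lra|].
rewrite plus_IZR.
assert (H0 := IZR_le _ _ (Z.le_min_l 0 (w * plower w p))).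
assert (H1 := IZR_le _ _ (Z.le_min_r 0 (w * plower w p))).
rewrite mult_IZR in H1.
set (m := IZR (plower w p)) in *.
assert (x * m <= x * peval p x) by (apply Rmult_le_compat_l; lra).
destruct (Rle_dec 0 m) as [Hm|Hm].
  assert (0 <= x * m) by (apply Rmult_le_pos; lra); lra.
assert (IZR w * m <= x * m) by nra; lra.
Qed.

(** The bound [plower] is crude on long intervals, hence the bisection, at most
    [fuel] levels deep. Conditionals replace the boolean connectives so that a
    call-by-value evaluation bisects only where it has to. *)
Fixpoint pnonneg (fuel : nat) (w : Z) (p : poly) : bool :=
  if (0 <=? plower w p)%Z then true else
  match fuel with
  | O => false
  | S fuel' =>
      let w' := (w / 2)%Z in
      if pnonneg fuel' w' p then pnonneg fuel' (w - w')%Z (pshift w' p) else false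
  end.

Lemma pnonneg_correct (fuel : nat) (w : Z) (p : poly) (x : R) :
  pnonneg fuel w p = true -> 0 <= x <= IZR w -> 0 <= peval p x.
Proof.
assert (base : forall w p x, (0 <=? plower w p)%Z = true ->
          0 <= x <= IZR w -> 0 <= peval p x).
  intros w0 p0 x0 H Hx; apply Z.leb_le, IZR_le in H.
  assert (K := plower_le w0 p0 x0 Hx); lra.
revert w p x; induction fuel as [|fuel IH]; intros w p x H Hx;
  cbn [pnonneg] in H; destruct (0 <=? plower w p)%Z eqn:H0;
  try discriminate; try now apply (base w).
set (w' := (w / 2)%Z) in *.
destruct (pnonneg fuel w' p) eqn:Hl; [|discriminate]; rename H into Hr.
destruct (Rle_dec x (IZR w')) as [Hx'|Hx'].
  now apply (IH w'); [|lra].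
replace x with (x - IZR w' + IZR w') by ring.
rewrite <- peval_shift; apply (IH (w - w')%Z); [exact Hr|].
rewrite minus_IZR; lra.
Qed.

(** Polynomials are written in the variable [z = 10 ^ 5 * tan (theta / 2)], and
    [|z| <= zmax] because [tan (eta / 2) = q / (sqrt S + p) < 0.12654]. *)
Definition zmax : Z := 12654.

Definition nonneg_on_range (p : poly) : bool :=
  pnonneg 12 (2 * zmax) (pshift (- zmax) p).

Lemma nonneg_on_range_correct (p : poly) (z : R) :
  nonneg_on_range p = true -> - IZR zmax <= z <= IZR zmax -> 0 <= peval p z.
Proof.
intros H Hz; apply pnonneg_correct with (x := z + IZR zmax) in H.
  rewrite peval_shift, opp_IZR in H.
  now replace (z + IZR zmax + - IZR zmax) with z in H by ring.
rewrite mult_IZR; lra.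
Qed.

(** * Balanced forces on a polygonal path *)

Definition pvec : Type := (poly * poly)%type.

(** Forces are polynomials divided by this unit: [10 ^ 14] clears the denominators
    of the multipliers below, [10 ^ 10] those of [t ^ 2], and [625565] those of
    the four rational directions. *)
Definition force_unit : Z := 625565 * 10 ^ 24.

Definition veval (v : pvec) (z : R) : pt :=
  (peval (fst v) z / IZR force_unit, peval (snd v) z / IZR force_unit).
Definition vadd (v w : pvec) : pvec := (padd (fst v) (fst w), padd (snd v) (snd w)).

Definition vzero (v : pvec) : bool :=
  forallb (fun c => Z.eqb c 0) (fst v) && forallb (fun c => Z.eqb c 0) (snd v).

Definition norm_le1 (v : pvec) : bool :=
  nonneg_on_range
    (padd [force_unit ^ 2]%Z
       (pscale (-1) (padd (pmul (fst v) (fst v)) (pmul (snd v) (snd v))))).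

(** A rope through the points in the order [o], pulled by the forces [f], is in
    equilibrium if every link bears the sum of the forces before it and nothing
    is left at the end; [d] is what the rope bears before its first point. *)
Fixpoint taut (f : label -> pvec) (d : pvec) (o : list label) : bool :=
  match o with
  | [] => false
  | a :: o' =>
      let d' := vadd d (f a) in
      match o' with
      | [] => vzero d'
      | _ => norm_le1 d' && taut f d' o'
      end
  end.

Fixpoint work (f : label -> pt) (X : label -> pt) (o : list label) : R :=
  match o with
  | [] => 0
  | a :: o' => dot (f a) (X a) + work f X o'
  end.

Lemma peval_zero (p : poly) (t : R) :
  forallb (fun c => Z.eqb c 0) p = true -> peval p t = 0.
Proof.
induction p as [|c p IH]; simpl; [reflexivity|].
intros H; apply andb_prop in H; destruct H as [Hc Hp].
apply Z.eqb_eq in Hc; rewrite Hc, (IH Hp); ring.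
Qed.

Lemma dist_ge_dot (v a b : pt) : dot v v <= 1 -> dot v a - dot v b <= dist a b.
Proof.
destruct v as [v1 v2], a as [a1 a2], b as [b1 b2]; unfold dot, dist, dist_euc, Rsqr; simpl.
intros Hv; set (x := a1 - b1); set (y := a2 - b2).
replace (v1 * a1 + v2 * a2 - (v1 * b1 + v2 * b2)) with (v1 * x + v2 * y)
  by (unfold x, y; ring).
apply Rle_trans with (Rabs (v1 * x + v2 * y)); [apply Rle_abs|].
rewrite <- sqrt_Rsqr_abs; apply sqrt_le_1_alt; unfold Rsqr.
apply Rle_trans with ((v1 * v1 + v2 * v2) * (x * x + y * y)).
  assert (H := pow2_ge_0 (v1 * y - v2 * x)); nra.
rewrite <- (Rmult_1_l (x * x + y * y)) at 2.
apply Rmult_le_compat_r; [nra|exact Hv].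
Qed.

Lemma dot_veval_add (v w : pvec) (t : R) (x : pt) :
  dot (veval (vadd v w) t) x = dot (veval v t) x + dot (veval w t) x.
Proof. unfold dot, veval, vadd; simpl; rewrite !peval_add; unfold Rdiv; ring. Qed.

Lemma norm_le1_correct (v : pvec) (t : R) :
  norm_le1 v = true -> - IZR zmax <= t <= IZR zmax ->
  dot (veval v t) (veval v t) <= 1.
Proof.
intros H Ht; assert (K := nonneg_on_range_correct _ t H Ht).
rewrite peval_add, peval_scale, peval_add, !peval_mul in K; cbn [peval] in K.
rewrite Z.pow_2_r, mult_IZR in K.
assert (Hu : 0 < IZR force_unit) by (apply IZR_lt; reflexivity).
unfold dot, veval; cbn [fst snd].
set (x := peval (fst v) t) in *; set (y := peval (snd v) t) in *.
set (u := IZR force_unit) in *.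
apply Rmult_le_reg_l with (u * u); [nra|].
replace (u * u * (x / u * (x / u) + y / u * (y / u))) with (x * x + y * y)
  by (field; lra).
lra.
Qed.

(** By the Cauchy-Schwarz inequality a link from [x] to [y] that bears [d] has
    length at least [d . x - d . y]; summation by parts turns the sum of these
    bounds into the sum over the points of the force times the position. *)
Lemma taut_le_len (f : label -> pvec) (d : pvec) (o : list label) (t : R)
    (X : label -> pt) :
  taut f d o = true -> - IZR zmax <= t <= IZR zmax ->
  work (fun l => veval (f l) t) X o + dot (veval d t) (hd (0, 0) (map X o))
    <= len (map X o).
Proof.
intros H Ht; revert d H; induction o as [|a o IH]; intros d H; [discriminate|].
destruct o as [|b o].
  cbn [taut] in H; apply andb_prop in H; destruct H as [H1 H2].
  apply (peval_zero _ t) in H1; apply (peval_zero _ t) in H2.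
  cbn [work map len hd]; assert (K := dot_veval_add d (f a) t (X a)).
  unfold dot at 1, veval at 1 2 in K; cbn [fst snd] in K.
  rewrite H1, H2 in K; unfold Rdiv in K; lra.
cbn [taut] in H; apply andb_prop in H; destruct H as [H1 H2].
specialize (IH _ H2); apply norm_le1_correct with (t := t) in H1; [|exact Ht].
apply (dist_ge_dot _ (X a) (X b)) in H1.
change (len (map X (a :: b :: o))) with (dist (X a) (X b) + len (map X (b :: o))).
change (hd (0, 0) (map X (b :: o))) with (X b) in IH.
change (hd (0, 0) (map X (a :: b :: o))) with (X a).
change (work (fun l => veval (f l) t) X (a :: b :: o))
  with (dot (veval (f a) t) (X a) + work (fun l => veval (f l) t) X (b :: o)).
rewrite dot_veval_add in H1; lra.
Qed.

(** * The two systems of forces *)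

(** The multipliers of the inequalities [Z1 + Q3 >= rho] and [Z2 + P2 >= rho], the
    two shares of the multiplier of [n_R + A + B >= rho] that act at [U] and [V],
    and the vertical force at [T], all in units of [10 ^ -14]. The shares are
    divided by [(1 + t ^ 2) sqrt S], because this factor makes the directions
    [n_R], [A] and [B] polynomial in [t] with integer coefficients. *)
Record multipliers := { a3_of : poly; a4_of : poly; u_of : poly; v_of : poly; tau_of : poly }.

Definition b_of (m : multipliers) : poly := padd (u_of m) (v_of m).

(** [pN], [pA], [pB] are [10 ^ 10 (1 + t ^ 2) sqrt S] times [n_R], [A], [B], in the
    variable [z]. *)
Definition pN : pvec :=
  ([197 * 10 ^ 10; - (2 * 766) * 10 ^ 5; - 197],
   [766 * 10 ^ 10; 2 * 197 * 10 ^ 5; - 766])%Z.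
Definition pA : pvec :=
  ([- (2 * 197) * 10 ^ 10; 0; 2 * 197], [0; - (4 * 197) * 10 ^ 5])%Z.
Definition pB : pvec :=
  ([197 * 10 ^ 10; 2 * 766 * 10 ^ 5; - 197],
   [- 766 * 10 ^ 10; 2 * 197 * 10 ^ 5; 766])%Z.

Definition fixed_force (m : poly) (x y : Z) : pvec :=
  (pscale (10 ^ 10 * x) m, pscale (10 ^ 10 * y) m).
Definition turning_force (m : poly) (v : pvec) : pvec :=
  (pscale 625565 (pmul m (fst v)), pscale 625565 (pmul m (snd v))).

(** Since [Z1 + Q3 = Z2 + P2 = (0, 1)] and [n_R + A + B = 0], the force at [F] is
    the one that makes the sum zero. *)
Definition force (m : multipliers) (l : label) : pvec :=
  match l with
  | LF => fixed_force (padd (a3_of m) (padd (a4_of m) (tau_of m))) 0 (- 625565)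
  | LT => fixed_force (tau_of m) 0 625565
  | LQ3 => fixed_force (a3_of m) (- 301804) 77618
  | LZ1 => fixed_force (a3_of m) 301804 547947
  | LZ2 => fixed_force (a4_of m) (- 301804) 547947
  | LP2 => fixed_force (a4_of m) 301804 77618
  | LU => turning_force (u_of m) pN
  | LV => turning_force (v_of m) pN
  | LA => turning_force (b_of m) pA
  | LB => turning_force (b_of m) pB
  | _ => ([], [])
  end.

(** The last condition is [(a3 + a4 + b) rho >= R] with [sqrt S] replaced by the
    smaller number 790.9266 and with denominators cleared. *)
Definition affords_bound (m : multipliers) : bool :=
  nonneg_on_range (a3_of m) && nonneg_on_range (a4_of m) && nonneg_on_range (b_of m) &&
  nonneg_on_range
    (padd [- (96717 * 10 ^ 23 * 625565)]%Z
       (pscale 301804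
          (padd (pscale (10 ^ 14) (padd (a3_of m) (a4_of m)))
                (pmul [7909266 * 10 ^ 10; 0; 7909266]%Z (b_of m))))).

(** Both systems are rounded numerical solutions of a convex program: among the
    multipliers that afford the bound, linear in [t] for the orders with [B] before
    [V] and constant for those with [V] before [B], keep the largest norm of a
    partial sum over the range of [t] as small as possible. In the first system
    some squared norms come within [4 * 10 ^ -6] of 1, hence the many digits; in the
    second one they stay [7 * 10 ^ -4] away from it. *)
Definition multBV : multipliers :=
  {| a3_of := []; a4_of := [88577960000000; 921571200]%Z;
     u_of := [54022250000; -1796931]%Z; v_of := [89146880000; 339668]%Z;
     tau_of := [-7708920000000; -1377985600]%Z |}.
Definition multVB : multipliers :=
  {| a3_of := [49050000000000]%Z; a4_of := [68220000000000]%Z; u_of := [48880000000]%Z;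
     v_of := [56320000000]%Z; tau_of := [-45260000000000]%Z |}.

Definition ordersBV : list (list label) :=
  flat_map (fun l => map (fun r => l ++ [LZ2; LU; LT; LB] ++ r)
    [[LV; LP2]; [LP2; LV]]) [[LF; LA]; [LA; LF]].
Definition ordersVB : list (list label) :=
  flat_map (fun l => map (fun r => l ++ [LZ2; LU; LT; LV] ++ r)
    [[LB; LP2; LZ1]; [LB; LZ1; LP2]; [LZ1; LP2; LB]; [LZ1; LB; LP2]])
    [[LF; LA; LQ3]; [LA; LF; LQ3]; [LA; LQ3; LF]; [LQ3; LA; LF]].

(** * Fitting the path into the triangle *)

Lemma sb_cb_pos : 0 < sb /\ 0 < cb /\ sb ^ 2 + cb ^ 2 = 1.
Proof.
assert (HS : 0 < sqrt SS) by (apply sqrt_lt_R0; unfold SS, pp, qq; lra).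
repeat split.
- unfold sb, pp; apply Rdiv_lt_0_compat; lra.
- unfold cb, qq; apply Rdiv_lt_0_compat; lra.
- unfold sb, cb; replace ((pp / sqrt SS) ^ 2 + (qq / sqrt SS) ^ 2)
    with ((pp ^ 2 + qq ^ 2) / (sqrt SS * sqrt SS)) by (field; lra).
  rewrite sqrt_SS2; unfold pp, qq; field.
Qed.

Lemma triangle_of_halfplanes (x y : R) :
  0 <= y -> sb * x + cb * y <= sb * cb -> - sb * x + cb * y <= sb * cb ->
  triangle (x, y).
Proof.
intros Hy H1 H2 C HC Hv; destruct sb_cb_pos as [Hs [Hc _]].
assert (Hys : y <= sb) by nra.
assert (apex : C (0, sb)) by (apply Hv; simpl; auto).
destruct (Req_dec y sb) as [->|Hne].
  replace x with 0 by nra; exact apex.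
(* The point lies on the segment from the base point (x', 0) to the apex. *)
set (t := y / sb); set (x' := x / (1 - t)).
assert (Et : sb * t = y) by (unfold t; field; lra).
assert (Ht : 0 <= t < 1).
  split; [unfold t; apply Rdiv_le_0_compat; lra|].
  apply Rmult_lt_reg_l with sb; lra.
assert (Ex : x' * (1 - t) = x) by (unfold x'; field; lra).
assert (Hx' : - cb <= x' <= cb).
  split; apply Rmult_le_reg_r with (sb * (1 - t)); try (apply Rmult_lt_0_compat; lra); nra.
assert (base : C (x', 0)).
  replace (x', 0) with (between ((x' + cb) / (2 * cb)) (- cb, 0) (cb, 0)).
    apply HC; [apply Hv; simpl; auto..|].
    split; [apply Rdiv_le_0_compat; lra|].
    apply Rmult_le_reg_r with (2 * cb); [lra|].
    unfold Rdiv; rewrite Rmult_assoc, Rinv_l; lra.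
  unfold between; simpl; f_equal; field; lra.
replace (x, y) with (between t (x', 0) (0, sb)).
  apply HC; [exact base|exact apex|lra].
unfold between; simpl; f_equal; lra.
Qed.

Lemma interior_triangle (x y : R) :
  0 < y -> sb * x + cb * y < sb * cb -> - sb * x + cb * y < sb * cb ->
  interior triangle (x, y).
Proof.
intros Hy H1 H2; destruct sb_cb_pos as [Hs [Hc H]].
assert (Hs1 : sb <= 1) by nra; assert (Hc1 : cb <= 1) by nra.
set (m := Rmin y (Rmin (sb * cb - (sb * x + cb * y)) (sb * cb - (- sb * x + cb * y)))).
assert (Hm : 0 < m) by (repeat apply Rmin_glb_lt; lra).
assert (M0 : m <= y) by apply Rmin_l.
assert (M1 : m <= sb * cb - (sb * x + cb * y))
  by (eapply Rle_trans; [apply Rmin_r|apply Rmin_l]).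
assert (M2 : m <= sb * cb - (- sb * x + cb * y))
  by (eapply Rle_trans; [apply Rmin_r|apply Rmin_r]).
clearbody m.
assert (Hm2 : 0 < m / 2) by lra.
exists (mkposreal _ Hm2); intros [x' y'] [Bx By].
change (Rabs (x' - x) < m / 2) in Bx; change (Rabs (y' - y) < m / 2) in By.
apply Rabs_def2 in Bx; apply Rabs_def2 in By.
apply triangle_of_halfplanes; nra.
Qed.

Lemma unit_angle (a b : R) :
  a ^ 2 + b ^ 2 = 1 -> exists phi, cos phi = a /\ sin phi = b.
Proof.
intros H; assert (Ha : -1 <= a <= 1) by nra.
assert (Hs : sqrt (1 - Rsqr a) = Rabs b).
  rewrite <- sqrt_Rsqr_abs; f_equal; unfold Rsqr; nra.
destruct (Rle_dec 0 b) as [Hb|Hb].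
- exists (acos a); rewrite cos_acos, sin_acos, Hs, Rabs_pos_eq by lra; auto.
- exists (- acos a); rewrite cos_neg, sin_neg, cos_acos, sin_acos, Hs by lra.
  rewrite Rabs_left by lra; split; ring.
Qed.

Lemma trace_in_halfplane (gam : path) (w : pt) (H : R) (x : pt) :
  (forall y, In y gam -> dot y w <= H) -> trace gam x -> dot x w <= H.
Proof.
intros Hg (i & a & b & [Ha Hb] & t & Ht & ->).
apply nth_error_In, Hg in Ha; apply nth_error_In, Hg in Hb.
revert Ha Hb; unfold dot, between; simpl; intros; nra.
Qed.

(** The outward normals of a rotated copy of the triangle, given the one of its
    base. *)
Definition leg1 (b : pt) : pt :=
  (- cb * fst b - sb * snd b, - cb * snd b + sb * fst b).
Definition leg2 (b : pt) : pt :=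
  (- cb * fst b + sb * snd b, - cb * snd b - sb * fst b).

(** If the inequality failed, the rotated path could be translated into the
    interior: a horizontal translation gives both legs the same slack, and a
    vertical one then divides the total slack between the base and the legs. *)
Lemma escape_support (gam : path) (b : pt) (H0 H1 H2 : R) :
  escape gam -> dot b b = 1 ->
  (forall x, In x gam -> dot x b <= H0) ->
  (forall x, In x gam -> dot x (leg1 b) <= H1) ->
  (forall x, In x gam -> dot x (leg2 b) <= H2) ->
  rho <= 2 * cb * H0 + H1 + H2.
Proof.
intros Hesc Hb G0 G1 G2; destruct (Rle_dec rho (2 * cb * H0 + H1 + H2)) as [|Hlt];
  [assumption|exfalso].
destruct sb_cb_pos as [Hs [Hc _]]; destruct b as [b1 b2].
unfold dot in Hb; simpl in Hb.
(* The rotation that takes the base normal to (0, -1). *)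
destruct (unit_angle (- b2) (- b1)) as [phi [Ec Es]]; [nra|].
set (e := (rho - (2 * cb * H0 + H1 + H2)) / (4 * cb)).
assert (He : 0 < e) by (apply Rdiv_lt_0_compat; lra).
assert (Ee : 4 * (cb * e) = rho - (2 * cb * H0 + H1 + H2)) by (unfold e; field; lra).
set (d := (H2 - H1) / (2 * sb)).
assert (Ed : 2 * (sb * d) = H2 - H1) by (unfold d; field; lra).
unfold rho in Ee.
apply (Hesc phi (d, H0 + e)); intros [x y] Hx.
assert (K0 := trace_in_halfplane _ _ _ _ G0 Hx).
assert (K1 := trace_in_halfplane _ _ _ _ G1 Hx).
assert (K2 := trace_in_halfplane _ _ _ _ G2 Hx).
unfold dot, leg1, leg2 in K0, K1, K2; simpl in K0, K1, K2.
unfold motion; simpl; rewrite Ec, Es; apply interior_triangle; nra.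
Qed.

(** A reflection swaps the legs, in which the inequality is symmetric, and a
    translation leaves it unchanged because the weighted normals add up to zero. *)
Lemma escape_support_rigid (gam : path) (g : pt -> pt) (b : pt) (H0 H1 H2 : R) :
  escape gam -> rigid g -> dot b b = 1 ->
  (forall x, In x (map g gam) -> dot x b <= H0) ->
  (forall x, In x (map g gam) -> dot x (leg1 b) <= H1) ->
  (forall x, In x (map g gam) -> dot x (leg2 b) <= H2) ->
  rho <= 2 * cb * H0 + H1 + H2.
Proof.
intros Hesc (e & phi & v & He & Hg) Hb G0 G1 G2.
set (pull := fun w : pt => (cos phi * fst w + sin phi * snd w,
                            e * (- sin phi * fst w + cos phi * snd w))).
assert (Ep : forall x w, dot (g x) w = dot v w + dot x (pull w)).
  intros x w; rewrite Hg; unfold dot, motion, pull; simpl; ring.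
assert (Hu : dot (pull b) (pull b) = 1).
  assert (T := sin2_cos2 phi); unfold Rsqr in T.
  unfold dot, pull in *; simpl.
  transitivity ((sin phi * sin phi + cos phi * cos phi)
                * (fst b * fst b + snd b * snd b)); [|rewrite T, Hb; ring].
  destruct He as [->| ->]; ring.
assert (pulled : forall w H, (forall x, In x (map g gam) -> dot x w <= H) ->
          forall x, In x gam -> dot x (pull w) <= H - dot v w).
  intros w H K x Hx; apply (in_map g), K in Hx; rewrite Ep in Hx; lra.
assert (P0 := pulled _ _ G0); assert (P1 := pulled _ _ G1); assert (P2 := pulled _ _ G2).
destruct He as [->| ->].
- assert (E1 : pull (leg1 b) = leg1 (pull b))
    by (unfold pull, leg1; simpl; f_equal; ring).
  assert (E2 : pull (leg2 b) = leg2 (pull b))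
    by (unfold pull, leg2; simpl; f_equal; ring).
  rewrite E1 in P1; rewrite E2 in P2.
  assert (K := escape_support _ _ _ _ _ Hesc Hu P0 P1 P2).
  unfold dot, leg1, leg2 in K; simpl in K; lra.
- assert (E1 : pull (leg1 b) = leg2 (pull b))
    by (unfold pull, leg1, leg2; simpl; f_equal; ring).
  assert (E2 : pull (leg2 b) = leg1 (pull b))
    by (unfold pull, leg1, leg2; simpl; f_equal; ring).
  rewrite E1 in P1; rewrite E2 in P2.
  assert (K := escape_support _ _ _ _ _ Hesc Hu P0 P2 P1).
  unfold dot, leg1, leg2 in K; simpl in K; lra.
Qed.

(** * The length of a path seen from some of its vertices *)

Lemma dist_refl (a : pt) : dist a a = 0.
Proof. apply distance_refl. Qed.

Lemma dist_tri (a b c : pt) : dist a c <= dist a b + dist b c.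
Proof. apply Rgeom.triangle. Qed.

Lemma dist_rigid (g : pt -> pt) (a b : pt) : rigid g -> dist (g a) (g b) = dist a b.
Proof.
intros (e & phi & v & He & Hg); rewrite !Hg.
unfold dist, dist_euc, motion, Rsqr; simpl; f_equal.
assert (T := sin2_cos2 phi); unfold Rsqr in T.
transitivity ((sin phi * sin phi + cos phi * cos phi)
  * ((fst a - fst b) * (fst a - fst b) + (snd a - snd b) * (snd a - snd b)));
  [destruct He as [->| ->]; ring | rewrite T; ring].
Qed.

Lemma len_rigid (g : pt -> pt) (gam : path) : rigid g -> len (map g gam) = len gam.
Proof.
intros Hg; induction gam as [|a [|b gam] IH]; try reflexivity.
change (dist (g a) (g b) + len (map g (b :: gam)) = dist a b + len (b :: gam)).
now rewrite IH, dist_rigid.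
Qed.

Lemma rigid_injective (g : pt -> pt) (a b : pt) : rigid g -> g a = g b -> a = b.
Proof.
intros Hg E; assert (H := dist_rigid g a b Hg); rewrite E, dist_refl in H.
symmetry in H; apply sqrt_eq_0 in H.
- apply Rplus_sqr_eq_0 in H; destruct a, b; simpl in H; f_equal; lra.
- apply Rplus_le_le_0_compat; apply Rle_0_sqr.
Qed.

Lemma NoDup_rigid (g : pt -> pt) (gam : path) :
  rigid g -> NoDup gam -> NoDup (map g gam).
Proof.
intros Hg; induction 1 as [|a gam Ha Hn IH]; simpl; constructor; [|assumption].
intros H; apply in_map_iff in H; destruct H as (b & E & Hb).
apply rigid_injective in E; [subst b; contradiction|assumption].
Qed.

Lemma skipn_nth {A : Type} (l : list A) (i : nat) (a : A) :
  nth_error l i = Some a -> skipn i l = a :: skipn (S i) l.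
Proof.
revert i; induction l as [|b l IH]; intros [|i] H; try discriminate.
- now injection H as ->.
- exact (IH i H).
Qed.

Lemma len_nonneg (gam : path) : 0 <= len gam.
Proof.
induction gam as [|a [|b gam] IH]; simpl in *; try lra.
assert (0 <= dist a b) by apply sqrt_pos; lra.
Qed.

Lemma len_shortcut (gam : path) (i j : nat) (a b : pt) :
  (i <= j)%nat -> nth_error gam i = Some a -> nth_error gam j = Some b ->
  dist a b + len (skipn j gam) <= len (skipn i gam).
Proof.
intros Hij; replace j with ((j - i) + i)%nat by lia.
generalize (j - i)%nat as k; clear Hij; intros k; revert i a.
induction k as [|k IH]; intros i a Ha Hb; [change (0 + i)%nat with i in *|].
  rewrite Ha in Hb; injection Hb as ->; rewrite dist_refl; lra.
destruct (nth_error gam (S i)) as [c|] eqn:Hc.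
- replace (S k + i)%nat with (k + S i)%nat in * by lia.
  specialize (IH (S i) c Hc Hb).
  rewrite (skipn_nth gam i a Ha), (skipn_nth gam (S i) c Hc).
  rewrite (skipn_nth gam (S i) c Hc) in IH.
  change (dist a b + len (skipn (k + S i) gam)
          <= dist a c + len (c :: skipn (S (S i)) gam)).
  assert (T := dist_tri a c b); lra.
- apply nth_error_None in Hc.
  assert (S k + i < length gam)%nat by (apply nth_error_Some; congruence); lia.
Qed.

Lemma len_through (gam : path) (X : label -> pt) (o : list label) :
  NoDup gam -> Sorted (fun l l' => weakly_before gam (X l) (X l')) o ->
  len (map X o) <= len gam.
Proof.
intros Hn Hs; destruct o as [|a [|b o]]; [apply len_nonneg..|].
assert (claim : forall o a i,
    Sorted (fun l l' => weakly_before gam (X l) (X l')) (a :: o) ->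
    nth_error gam i = Some (X a) -> len (map X (a :: o)) <= len (skipn i gam)).
  clear - Hn; intros o; induction o as [|b o IH]; intros a i Hs Hi; [apply len_nonneg|].
  apply Sorted_inv in Hs; destruct Hs as [Hs Hab]; apply HdRel_inv in Hab.
  destruct Hab as (i' & j & Hij & Hi' & Hj).
  assert (i' = i) as ->.
    apply (proj1 (NoDup_nth_error gam) Hn); [apply nth_error_Some|]; congruence.
  assert (H1 := len_shortcut gam i j _ _ Hij Hi Hj); assert (H2 := IH b j Hs Hj).
  change (dist (X a) (X b) + len (map X (b :: o)) <= len (skipn i gam)); lra.
assert (Hab := Hs); apply Sorted_inv in Hab; destruct Hab as [_ Hab].
apply HdRel_inv in Hab; destruct Hab as (i & _ & _ & Hi & _).
apply claim with (i := i) in Hs; [|exact Hi].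
destruct gam as [|c gam]; [destruct i; discriminate|].
assert (H1 := len_shortcut (c :: gam) 0 i c _ (Nat.le_0_l i) eq_refl Hi).
assert (0 <= dist c (X a)) by apply sqrt_pos.
rewrite skipn_O in H1; lra.
Qed.

(** * Order of the marked contacts along the path *)

Definition label_eq_dec (a b : label) : {a = b} + {a <> b}.
Proof. decide equality. Defined.

Fixpoint visit_rank (ord : list label) (l : label) : nat :=
  match ord with
  | [] => 0
  | a :: ord' => if label_eq_dec a l then 0 else S (visit_rank ord' l)
  end.

Lemma nth_visit_rank (ord : list label) (l : label) :
  In l ord -> nth_error ord (visit_rank ord l) = Some l.
Proof.
induction ord as [|a ord IH]; simpl; [tauto|].
destruct (label_eq_dec a l) as [->|Hne]; [reflexivity|].
now intros [|H]; [|apply IH].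
Qed.

Lemma visit_rank_nth (ord : list label) (i : nat) (l : label) :
  NoDup ord -> nth_error ord i = Some l -> visit_rank ord l = i.
Proof.
intros Hn Hi; assert (Hl := nth_error_In _ _ Hi).
apply (proj1 (NoDup_nth_error ord) Hn).
- apply nth_error_Some; rewrite (nth_visit_rank _ _ Hl); discriminate.
- rewrite (nth_visit_rank _ _ Hl); congruence.
Qed.

Lemma before_visit_rank (ord : list label) (a b : label) :
  NoDup ord -> before ord a b -> (visit_rank ord a < visit_rank ord b)%nat.
Proof.
intros Hn (i & j & Hij & Hi & Hj).
now rewrite (visit_rank_nth _ _ _ Hn Hi), (visit_rank_nth _ _ _ Hn Hj).
Qed.

Lemma ForallOrdPairs_nth {A : Type} (r : A -> A -> Prop) (l : list A) (i j : nat) (a b : A) :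
  ForallOrdPairs r l -> (i < j)%nat ->
  nth_error l i = Some a -> nth_error l j = Some b -> r a b.
Proof.
intros H; revert i j; induction H as [|c l Hc Hl IH]; intros [|i] [|j] Hij Hi Hj;
  try discriminate; try lia.
- injection Hi as <-; apply (nth_error_In l j) in Hj.
  exact (proj1 (List.Forall_forall _ _) Hc b Hj).
- apply (IH i j); [lia|assumption..].
Qed.

Lemma in_skipn_visit_rank (ord : list label) (k : nat) (l : label) :
  NoDup ord -> In l ord -> In l (skipn k ord) <-> (k <= visit_rank ord l)%nat.
Proof.
intros Hn Hl; split; intros H.
- apply In_nth_error in H; destruct H as [i Hi]; rewrite nth_error_skipn in Hi.
  rewrite (visit_rank_nth _ _ _ Hn Hi); lia.
- apply nth_error_In with (n := (visit_rank ord l - k)%nat); rewrite nth_error_skipn.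
  now replace (k + (visit_rank ord l - k))%nat with (visit_rank ord l) by lia; apply nth_visit_rank.
Qed.

Lemma fan_all (l : label) : In l fan.
Proof. destruct l; simpl; tauto. Qed.

Definition fan_arcs : list (list label) :=
  flat_map (fun r => map (fun m => firstn m (skipn r fan ++ firstn r fan)) (seq 0 16))
    (seq 0 16).

Lemma fan_interval_in_arcs (ls : list label) :
  fan_interval ls -> exists arc, In arc fan_arcs /\ Permutation ls arc.
Proof.
intros (r & m & H); exists (firstn (min m 15) (skipn (min r 15) fan ++ firstn (min r 15) fan)).
split.
  apply in_flat_map; exists (min r 15); split; [apply in_seq; lia|].
  apply in_map_iff; exists (min m 15); split; [reflexivity|apply in_seq; lia].
assert (E : skipn (min r 15) fan ++ firstn (min r 15) fan = skipn r fan ++ firstn r fan).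
  destruct (Nat.le_ge_cases r 15) as [Hr|Hr]; [now rewrite Nat.min_l|].
  rewrite Nat.min_r by exact Hr; rewrite (skipn_all2 fan Hr), (firstn_all2 fan Hr).
  reflexivity.
rewrite E; destruct (Nat.le_ge_cases m 15) as [Hm|Hm]; [now rewrite Nat.min_l|].
rewrite Nat.min_r by exact Hm.
assert (Hlen : length (skipn r fan ++ firstn r fan) = 15%nat).
  rewrite length_app, length_skipn, length_firstn; simpl length; lia.
rewrite firstn_all2 by lia; rewrite firstn_all2 in H by lia; exact H.
Qed.

Definition label_mem (l : label) (ls : list label) : bool :=
  if in_dec label_eq_dec l ls then true else false.

Definition crossing (a b c d : label) : bool :=
  forallb (fun arc =>
    negb (label_mem a arc && label_mem c arc &&
          negb (label_mem b arc) && negb (label_mem d arc))) fan_arcs.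

(** The unvisited labels form an arc at any time. Hence two labels [b], [d] cannot
    both be visited before both of [a], [c] when the two pairs alternate on the
    cyclic fan. *)
Lemma no_crossing (ord : list label) (a b c d : label) :
  Permutation fan ord -> NoDup ord -> (forall k, fan_interval (skipn k ord)) ->
  crossing a b c d = true ->
  (visit_rank ord b < visit_rank ord a -> visit_rank ord d < visit_rank ord a ->
   visit_rank ord b < visit_rank ord c -> visit_rank ord d < visit_rank ord c -> False)%nat.
Proof.
intros Hp Hn Hf Hc Hba Hda Hbc Hdc.
assert (Hin : forall l, In l ord) by (intros l; apply (Permutation_in l Hp), fan_all).
set (k := S (Nat.max (visit_rank ord b) (visit_rank ord d))).
destruct (fan_interval_in_arcs _ (Hf k)) as (arc & Harc & Hperm).
apply (proj1 (forallb_forall _ _) Hc) in Harc; revert Harc.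
assert (In_arc : forall l, In l arc <-> (k <= visit_rank ord l)%nat).
  intros l; rewrite <- (in_skipn_visit_rank ord k l Hn (Hin l)).
  split; apply Permutation_in; [now apply Permutation_sym|assumption].
unfold label_mem.
destruct (in_dec label_eq_dec a arc) as [|Ha]; [|exfalso; apply Ha, In_arc; lia].
destruct (in_dec label_eq_dec c arc) as [|Hc']; [|exfalso; apply Hc', In_arc; lia].
destruct (in_dec label_eq_dec b arc) as [Hb|]; [exfalso; apply In_arc in Hb; lia|].
destruct (in_dec label_eq_dec d arc) as [Hd|]; [exfalso; apply In_arc in Hd; lia|].
discriminate.
Qed.

Ltac sorted_by_lia :=
  cbn [app];
  repeat first [assumption | apply Sorted_nil | apply Sorted_cons
               | apply HdRel_nil | apply HdRel_cons; lia].

(** All precedences come from quadruples that alternate on the fan. For instance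
    [A] precedes [Z2], since otherwise the visited labels [F] and [Z2] would separate
    the unvisited ones [A] and [T]. *)
Lemma deque_orders (ord : list label) :
  Permutation fan ord -> (forall k, fan_interval (skipn k ord)) ->
  stated_incidences ord ->
  exists o, (In o ordersBV \/ In o ordersVB) /\
    Sorted (fun a b => (visit_rank ord a < visit_rank ord b)%nat) o.
Proof.
intros Hp Hf (FM & MT & TZ1 & FZ2 & Z2T & FU & UT & TV).
assert (Hn : NoDup ord).
  apply (Permutation_NoDup Hp); repeat constructor; simpl; intuition discriminate.
assert (inj : forall a b, a <> b -> visit_rank ord a <> visit_rank ord b).
  intros a b Hab E; apply Hab.
  assert (Ha := nth_visit_rank ord a (Permutation_in a Hp (fan_all a))).
  assert (Hb := nth_visit_rank ord b (Permutation_in b Hp (fan_all b))).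
  rewrite E in Ha; congruence.
apply (before_visit_rank _ _ _ Hn) in FM, MT, TZ1, FZ2, Z2T, FU, UT, TV.
pose (P := visit_rank ord); fold P in inj, FM, MT, TZ1, FZ2, Z2T, FU, UT, TV |- *.
assert (cross : forall a b c d, crossing a b c d = true ->
    (P b < P a -> P d < P a -> P b < P c -> P d < P c -> False)%nat)
  by (intros a b c d H; exact (no_crossing ord a b c d Hp Hn Hf H)).
(* If the pairs a, c and b, d alternate, then a precedes b as soon as one of a and b
   is visited between d and c. *)
assert (early : forall a b c d, crossing a b c d = true -> a <> b ->
    (P d < P b -> P b < P c -> P a < P b)%nat).
  intros a b c d H Hab Hdb Hbc; assert (K := cross a b c d H); assert (I := inj a b Hab).
  clear - Hdb Hbc K I; destruct (Nat.lt_ge_cases (P a) (P b)); [assumption|].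
  exfalso; apply K; lia.
assert (late : forall a b c d, crossing a b c d = true -> a <> b ->
    (P d < P a -> P a < P c -> P a < P b)%nat).
  intros a b c d H Hab Hda Hac; assert (K := cross a b c d H); assert (I := inj a b Hab).
  clear - Hda Hac K I; destruct (Nat.lt_ge_cases (P a) (P b)); [assumption|].
  exfalso; apply K; lia.
assert (AZ2 : (P LA < P LZ2)%nat)
  by now apply (early LA LZ2 LT LF eq_refl ltac:(discriminate)).
assert (QZ2 : (P LQ3 < P LZ2)%nat)
  by now apply (early LQ3 LZ2 LT LF eq_refl ltac:(discriminate)).
assert (Z2U : (P LZ2 < P LU)%nat)
  by now apply (early LZ2 LU LT LF eq_refl ltac:(discriminate)).
assert (TB : (P LT < P LB)%nat)
  by now apply (late LT LB LV LU eq_refl ltac:(discriminate)).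
assert (TP : (P LT < P LP2)%nat)
  by now apply (late LT LP2 LV LU eq_refl ltac:(discriminate)).
assert (FAQ := cross LA LQ3 LT LF eq_refl).
assert (ZPB := cross LZ1 LP2 LB LT eq_refl).
assert (nFA := inj LF LA ltac:(discriminate)).
assert (nFQ := inj LF LQ3 ltac:(discriminate)).
assert (nAQ := inj LA LQ3 ltac:(discriminate)).
assert (nVB := inj LV LB ltac:(discriminate)).
assert (nVP := inj LV LP2 ltac:(discriminate)).
assert (nZP := inj LZ1 LP2 ltac:(discriminate)).
assert (nZB := inj LZ1 LB ltac:(discriminate)).
assert (nPB := inj LP2 LB ltac:(discriminate)).
pose (inc o := Sorted (fun a b => (P a < P b)%nat) o).
destruct (Nat.lt_ge_cases (P LB) (P LV)) as [BV|VB].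
- assert (BP : (P LB < P LP2)%nat)
    by now apply (late LB LP2 LV LT eq_refl ltac:(discriminate)).
  clear early late cross inj FAQ ZPB Hf.
  assert (left : exists l, In l [[LF; LA]; [LA; LF]] /\
      forall r, inc (LZ2 :: r) -> inc (l ++ LZ2 :: r)).
    destruct (Nat.lt_ge_cases (P LF) (P LA));
      [exists [LF; LA] | exists [LA; LF]];
      (split; [simpl; tauto | intros r Hr; unfold inc in *; sorted_by_lia]).
  assert (right : exists r, In r [[LV; LP2]; [LP2; LV]] /\ inc (LB :: r)).
    destruct (Nat.lt_ge_cases (P LV) (P LP2));
      [exists [LV; LP2] | exists [LP2; LV]];
      (split; [simpl; tauto | unfold inc in *; sorted_by_lia]).
  destruct left as (l & Hl & Il), right as (r & Hr & Ir).
  exists (l ++ [LZ2; LU; LT; LB] ++ r); split.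
    left; apply in_flat_map; exists l; split; [exact Hl|].
    now apply in_map with (f := fun r => l ++ [LZ2; LU; LT; LB] ++ r).
  apply Il; unfold inc in *; sorted_by_lia.
- assert (VB' : (P LV < P LB)%nat) by (clear - VB nVB; lia).
  assert (VZ : (P LV < P LZ1)%nat)
    by now apply (late LV LZ1 LB LT eq_refl ltac:(discriminate)).
  assert (VP : (P LV < P LP2)%nat)
    by now apply (late LV LP2 LB LT eq_refl ltac:(discriminate)).
  clear early late cross inj Hf.
  assert (left : exists l, In l [[LF; LA; LQ3]; [LA; LF; LQ3]; [LA; LQ3; LF]; [LQ3; LA; LF]] /\
      forall r, inc (LZ2 :: r) -> inc (l ++ LZ2 :: r)).
    destruct (Nat.lt_ge_cases (P LF) (P LA));
    destruct (Nat.lt_ge_cases (P LF) (P LQ3));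
    destruct (Nat.lt_ge_cases (P LA) (P LQ3));
    try (exfalso; first [lia | apply FAQ; lia]);
    [exists [LF; LA; LQ3] | exists [LA; LF; LQ3] | exists [LA; LQ3; LF] | exists [LQ3; LA; LF]];
      (split; [simpl; tauto | intros s Hs; unfold inc in *; sorted_by_lia]).
  assert (right : exists r, In r [[LB; LP2; LZ1]; [LB; LZ1; LP2]; [LZ1; LP2; LB]; [LZ1; LB; LP2]] /\
      inc (LV :: r)).
    destruct (Nat.lt_ge_cases (P LZ1) (P LB));
    destruct (Nat.lt_ge_cases (P LZ1) (P LP2));
    destruct (Nat.lt_ge_cases (P LP2) (P LB));
    try (exfalso; first [lia | apply ZPB; lia]);
    [exists [LZ1; LP2; LB] | exists [LZ1; LB; LP2] | exists [LB; LZ1; LP2] | exists [LB; LP2; LZ1]];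
      (split; [simpl; tauto | unfold inc in *; sorted_by_lia]).
  destruct left as (l & Hl & Il), right as (r & Hr & Ir).
  exists (l ++ [LZ2; LU; LT; LV] ++ r); split.
    right; apply in_flat_map; exists l; split; [exact Hl|].
    now apply in_map with (f := fun r => l ++ [LZ2; LU; LT; LV] ++ r).
  apply Il; unfold inc in *; sorted_by_lia.
Qed.

(** * The forces outweigh the bound *)

(** [dirN], [dirA], [dirB] are [(1 + t ^ 2) sqrt S] times [n_R], [A], [B]. *)
Definition dirN (t : R) : pt :=
  (197 * (1 - t ^ 2) - 2 * 766 * t, 766 * (1 - t ^ 2) + 2 * 197 * t).
Definition dirA (t : R) : pt := (- (2 * 197) * (1 - t ^ 2), - (4 * 197) * t).
Definition dirB (t : R) : pt :=
  (197 * (1 - t ^ 2) + 2 * 766 * t, 2 * 197 * t - 766 * (1 - t ^ 2)).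

Lemma force_unit_eq : IZR force_unit = 625565 * 10 ^ 24.
Proof. unfold force_unit; rewrite mult_IZR; change (10 ^ 24)%Z with (Z.pow 10 (Z.of_nat 24)).
rewrite <- pow_IZR; reflexivity. Qed.

Lemma dot_fixed_force (m : poly) (a b : Z) (z : R) (x : pt) :
  dot (veval (fixed_force m a b) z) x
  = peval m z / 10 ^ 14 * (IZR a / 625565 * fst x + IZR b / 625565 * snd x).
Proof.
unfold dot, veval, fixed_force; cbn [fst snd].
rewrite !peval_scale, !mult_IZR, force_unit_eq.
change (10 ^ 10)%Z with (Z.pow 10 (Z.of_nat 10)); rewrite <- pow_IZR; field.
Qed.

Lemma dot_turning_force (m : poly) (v : pvec) (z : R) (x : pt) :
  dot (veval (turning_force m v) z) x
  = peval m z / 10 ^ 14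
    * (peval (fst v) z / 10 ^ 10 * fst x + peval (snd v) z / 10 ^ 10 * snd x).
Proof.
unfold dot, veval, turning_force; cbn [fst snd].
rewrite !peval_scale, !peval_mul, force_unit_eq; field.
Qed.

Lemma turning_force_directions (m : poly) (t : R) (x : pt) :
  let z := 10 ^ 5 * t in
  let k := peval m z / 10 ^ 14 in
  dot (veval (turning_force m pN) z) x = k * dot (dirN t) x /\
  dot (veval (turning_force m pA) z) x = k * dot (dirA t) x /\
  dot (veval (turning_force m pB) z) x = k * dot (dirB t) x.
Proof.
intros z k; rewrite !dot_turning_force; fold k.
unfold pN, pA, pB, dirN, dirA, dirB, dot, z; cbn [fst snd].
change (10 ^ 10)%Z with 10000000000%Z; change (10 ^ 5)%Z with 100000%Z.
cbn [peval]; repeat rewrite ?mult_IZR, ?opp_IZR.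
repeat split; field.
Qed.

Lemma sqrt_SS_ge : 7909266 / 10 ^ 4 <= sqrt SS.
Proof.
rewrite <- (sqrt_pow2 (7909266 / 10 ^ 4)) by lra.
apply sqrt_le_1_alt; unfold SS, pp, qq; lra.
Qed.

Definition total_work (m : multipliers) (z : R) (X : label -> pt) : R :=
  work (fun l => veval (force m l) z) X [LF; LA; LQ3; LZ2; LU; LT; LV; LZ1; LP2; LB].

(** The points [U] and [V] have the same component along [n_R], so the shares that
    act at them do the same work as their sum at [U]. *)
Lemma total_work_ge (m : multipliers) (t : R) (X : label -> pt) :
  affords_bound m = true -> - IZR zmax <= 10 ^ 5 * t <= IZR zmax ->
  snd (X LF) = 0 -> snd (X LT) = 0 ->
  dot (dirN t) (X LU) = dot (dirN t) (X LV) ->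
  rho <= dot (rho, kappa) (X LZ1) + dot (- rho, chi) (X LQ3) ->
  rho <= dot (- rho, kappa) (X LZ2) + dot (rho, chi) (X LP2) ->
  (1 + t ^ 2) * sqrt SS * rho
    <= dot (dirN t) (X LU) + dot (dirA t) (X LA) + dot (dirB t) (X LB) ->
  Rbound <= total_work m (10 ^ 5 * t) X.
Proof.
intros W Hz HF HT HUV H3 H4 H7.
unfold affords_bound in W; apply andb_prop in W; destruct W as [W W0].
apply andb_prop in W; destruct W as [W Wb].
apply andb_prop in W; destruct W as [W3 W4].
apply nonneg_on_range_correct with (z := 10 ^ 5 * t) in W0, Wb, W3, W4; try exact Hz.
unfold total_work; cbn [work force].
rewrite !dot_fixed_force, HF, HT.
destruct (turning_force_directions (u_of m) t (X LU)) as [EU _].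
destruct (turning_force_directions (v_of m) t (X LV)) as [EV _].
destruct (turning_force_directions (b_of m) t (X LA)) as [_ [EA _]].
destruct (turning_force_directions (b_of m) t (X LB)) as [_ [_ EB]].
rewrite EU, EV, EA, EB, <- HUV; clear EU EV EA EB.
rewrite peval_add, peval_scale, peval_add, peval_scale, peval_add, peval_mul in W0.
cbn [peval] in W0; rewrite opp_IZR in W0.
rewrite !mult_IZR in W0.
change (10 ^ 23)%Z with (Z.pow 10 (Z.of_nat 23)) in W0.
change (10 ^ 14)%Z with (Z.pow 10 (Z.of_nat 14)) in W0.
change (10 ^ 10)%Z with (Z.pow 10 (Z.of_nat 10)) in W0.
rewrite <- !pow_IZR in W0.
set (a3 := peval (a3_of m) (10 ^ 5 * t)) in *.
set (a4 := peval (a4_of m) (10 ^ 5 * t)) in *.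
assert (EN : peval (b_of m) (10 ^ 5 * t)
             = peval (u_of m) (10 ^ 5 * t) + peval (v_of m) (10 ^ 5 * t))
  by apply peval_add.
rewrite EN in *.
set (u := peval (u_of m) (10 ^ 5 * t)) in *; set (v := peval (v_of m) (10 ^ 5 * t)) in *.
assert (HS := sqrt_SS_ge).
assert (K3 : 0 <= a3 / 10 ^ 14) by (apply Rdiv_le_0_compat; lra).
assert (K4 : 0 <= a4 / 10 ^ 14) by (apply Rdiv_le_0_compat; lra).
assert (K7 : 0 <= (u + v) / 10 ^ 14) by (apply Rdiv_le_0_compat; lra).
apply (Rmult_le_compat_l _ _ _ K3) in H3.
apply (Rmult_le_compat_l _ _ _ K4) in H4.
assert (H7' : (1 + t ^ 2) * (7909266 / 10 ^ 4) * rho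
    <= dot (dirN t) (X LU) + dot (dirA t) (X LA) + dot (dirB t) (X LB)).
  eapply Rle_trans; [|exact H7].
  apply Rmult_le_compat_r; [rewrite rhoE; lra|].
  apply Rmult_le_compat_l; [nra|exact HS].
apply (Rmult_le_compat_l _ _ _ K7) in H7'.
apply Rle_trans with (a3 / 10 ^ 14 * rho + a4 / 10 ^ 14 * rho
  + (u + v) / 10 ^ 14 * ((1 + t ^ 2) * (7909266 / 10 ^ 4) * rho)).
- rewrite rhoE; unfold Rbound.
  apply Rmult_le_reg_l with (10 ^ 28 * 625565); [lra|].
  clearbody a3 a4 u v; clear - W0; field_simplify; field_simplify in W0; lra.
- eapply Rle_trans; [exact (Rplus_le_compat _ _ _ _ (Rplus_le_compat _ _ _ _ H3 H4) H7')|].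
  right; rewrite rhoE, kappaE, chiE; unfold dot; cbn [fst snd]; field.
Qed.

(** * Support inequalities at the marked contacts *)

Lemma beta_bounds : 0 < beta < PI / 2.
Proof.
split; [|apply atan_bound].
unfold beta; rewrite <- atan_0; apply atan_increasing; unfold pp, qq; lra.
Qed.

Lemma cos_sin_beta : cos beta = cb /\ sin beta = sb.
Proof.
assert (HS : 0 < sqrt SS) by (assert (H := sqrt_SS_ge); lra).
assert (E : sqrt (1 + (pp / qq)²) = sqrt SS / qq).
  replace (1 + (pp / qq)²) with (SS / qq²) by (unfold SS, Rsqr, pp, qq; field).
  rewrite sqrt_div_alt by (unfold Rsqr, qq; lra).
  rewrite sqrt_Rsqr by (unfold qq; lra); reflexivity.
unfold beta; rewrite cos_atan, sin_atan, E; unfold cb, sb, qq; split; field; lra.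
Qed.

Lemma half_angle (theta t : R) :
  - eta <= theta <= eta -> t = tan (theta / 2) -> cos theta = CR t /\ sin theta = SR t.
Proof.
intros Hth ->; assert (Hb := beta_bounds); assert (HP := PI_RGT_0).
assert (Hc : 0 < cos (theta / 2)) by (apply cos_gt_0; unfold eta in Hth; lra).
assert (T := sin2_cos2 (theta / 2)); unfold Rsqr in T.
replace theta with (2 * (theta / 2)) at 1 3 by field.
rewrite cos_2a, sin_2a; unfold CR, SR, tan.
set (c := cos (theta / 2)) in *; set (s := sin (theta / 2)) in *.
assert (D : 1 + (s / c) ^ 2 = 1 / (c * c)) by (rewrite <- T at 2; field; lra).
rewrite D; split; field; lra.
Qed.

(** [tan (eta / 2) = sin eta / (1 + cos eta) = c / (1 + s) = q / (sqrt S + p)]. *)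
Lemma tstar_le : tstar <= 12654 / 10 ^ 5.
Proof.
assert (Hb := beta_bounds); assert (HP := PI_RGT_0).
assert (Hc : 0 < cos (eta / 2)) by (apply cos_gt_0; unfold eta; lra).
destruct cos_sin_beta as [Ec Es].
assert (E1 : 2 * sin (eta / 2) * cos (eta / 2) = cb).
  rewrite <- sin_2a, <- Ec, <- sin_shift; f_equal; unfold eta; field.
assert (E2 : 2 * cos (eta / 2) * cos (eta / 2) = 1 + sb).
  assert (E := cos_2a_cos (eta / 2)); replace (2 * (eta / 2)) with eta in E by field.
  unfold eta at 1 in E; rewrite cos_shift, Es in E; lra.
assert (E : tstar * (sqrt SS + 766) = 197).
  assert (HS : 0 < sqrt SS) by (assert (H := sqrt_SS_ge); lra).
  replace (sqrt SS + 766) with (sqrt SS * (1 + sb)) by (unfold sb, pp; field; lra).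
  replace 197 with (sqrt SS * cb) by (unfold cb, qq; field; lra).
  rewrite <- E1, <- E2; unfold tstar, tan; field; lra.
assert (H := sqrt_SS_ge).
apply Rmult_le_reg_r with (sqrt SS + 766); [lra|]; rewrite E; lra.
Qed.

Lemma vertex_in_hull (gam : path) (y : pt) :
  (2 <= length gam)%nat -> In y gam -> hull gam y.
Proof.
intros Hl Hy C _ HC; apply HC; apply In_nth_error in Hy; destruct Hy as [i Hi].
assert (Hi' : (i < length gam)%nat) by (apply nth_error_Some; congruence).
destruct (nth_error gam (S i)) as [b|] eqn:Hb.
- exists i, y, b; split; [now split|]; exists 0; split; [lra|].
  unfold between; destruct y; simpl; f_equal; ring.
- apply nth_error_None in Hb; destruct i as [|i]; [lia|].
  destruct (nth_error gam i) as [a|] eqn:Ha; [|apply nth_error_None in Ha; lia].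
  exists i, a, y; split; [now split|]; exists 1; split; [lra|].
  unfold between; destruct y; simpl; f_equal; ring.
Qed.

(** For the base normal [(- s, c)], along [Q3], the legs have normals [(0, -1)] and
    [Z1]; for [(s, c)], along [P2], they have [Z2] and [(0, -1)]; for
    [- u_theta], along [A], they have [B] and [n_R]. *)
Lemma marked_support_inequalities (gamma : path) (g : pt -> pt) (thetaR t : R)
    (X : label -> pt) :
  escape gamma -> rigid g -> - eta <= thetaR <= eta -> t = tan (thetaR / 2) ->
  snd (X LF) = 0 ->
  (forall l y, In y (map g gamma) ->
     dot y (direction thetaR t l) <= dot (X l) (direction thetaR t l)) ->
  rho <= dot (rho, kappa) (X LZ1) + dot (- rho, chi) (X LQ3) /\
  rho <= dot (- rho, kappa) (X LZ2) + dot (rho, chi) (X LP2) /\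
  (1 + t ^ 2) * sqrt SS * rho
    <= dot (dirN t) (X LU) + dot (dirA t) (X LA) + dot (dirB t) (X LB).
Proof.
intros Hesc Hg Hth Ht HF HX; destruct sb_cb_pos as [Hs [Hc H1]].
assert (HS : 0 < sqrt SS) by (assert (H := sqrt_SS_ge); lra).
assert (base : forall b x y, dot y (scale (2 * cb) b) <= dot x (scale (2 * cb) b) ->
    dot y b <= dot x b).
  intros b x y H; apply Rmult_le_reg_l with (2 * cb); [lra|].
  revert H; unfold dot, scale; simpl; lra.
assert (down : forall y, In y (map g gamma) -> dot y (0, -1) <= 0).
  intros y Hy; apply (HX LF) in Hy; revert Hy; unfold dot; simpl; rewrite HF; lra.
split; [|split].
- assert (K := escape_support_rigid gamma g (- sb, cb)
    (dot (X LQ3) (- sb, cb)) 0 (dot (X LZ1) (rho, kappa)) Hesc Hg).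
  assert (E1 : leg1 (- sb, cb) = (0, -1))
    by (unfold leg1; simpl; f_equal; [ring|nra]).
  assert (E2 : leg2 (- sb, cb) = (rho, kappa))
    by (unfold leg2, rho, kappa; simpl; f_equal; ring).
  rewrite E1, E2 in K; eapply Rle_trans; [apply K|].
  + unfold dot; simpl; nra.
  + intros y Hy; apply base, (HX LQ3), Hy.
  + exact down.
  + intros y Hy; exact (HX LZ1 y Hy).
  + right; unfold dot, rho, chi; simpl; ring.
- assert (K := escape_support_rigid gamma g (sb, cb)
    (dot (X LP2) (sb, cb)) (dot (X LZ2) (- rho, kappa)) 0 Hesc Hg).
  assert (E1 : leg1 (sb, cb) = (- rho, kappa))
    by (unfold leg1, rho, kappa; simpl; f_equal; ring).
  assert (E2 : leg2 (sb, cb) = (0, -1))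
    by (unfold leg2; simpl; f_equal; [ring|nra]).
  rewrite E1, E2 in K; eapply Rle_trans; [apply K|].
  + unfold dot; simpl; nra.
  + intros y Hy; apply base, (HX LP2), Hy.
  + intros y Hy; exact (HX LZ2 y Hy).
  + exact down.
  + right; unfold dot, rho, chi; simpl; ring.
- assert (HA := HX LA); assert (HB := HX LB); assert (HU := HX LU); clear HX.
  destruct (half_angle thetaR t Hth Ht) as [EC ES].
  destruct cos_sin_beta as [Ec Es].
  assert (Hd : 0 < 1 + t ^ 2) by (assert (H := pow2_ge_0 t); lra).
  set (b := (- CR t, - SR t)).
  assert (Hb : dot b b = 1) by (unfold dot, b, CR, SR; simpl; field; lra).
  assert (EA : direction thetaR t LA = scale (2 * cb) b)
    by (cbn [direction]; unfold b, cb, scale; simpl; f_equal; field; lra).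
  assert (EB : direction thetaR t LB = leg1 b)
    by (cbn [direction]; unfold b, leg1, cb, sb, scale; simpl; f_equal; field; lra).
  assert (EU : direction thetaR t LU = leg2 b).
    simpl; unfold normR, uvec, b, leg2; simpl.
    rewrite cos_plus, sin_plus, Ec, Es, EC, ES; f_equal; ring.
  rewrite EA in HA; rewrite EB in HB; rewrite EU in HU.
  assert (K := escape_support_rigid gamma g b (dot (X LA) b) (dot (X LB) (leg1 b))
    (dot (X LU) (leg2 b)) Hesc Hg Hb (fun y Hy => base b _ y (HA y Hy)) HB HU).
  apply Rmult_le_compat_l with (r := (1 + t ^ 2) * sqrt SS) in K;
    [|apply Rmult_le_pos; lra].
  eapply Rle_trans; [exact K|right].
  unfold dot, leg1, leg2, b, dirN, dirA, dirB, CR, SR, cb, sb, pp, qq; simpl.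
  field; lra.
Qed.

(** * The bound for the path *)

(** [Q3] and [Z1] carry no force when the multiplier [a3] is zero, so the orders in
    [ordersBV] leave them out. *)
Lemma work_BV (z : R) (X : label -> pt) (o : list label) :
  In o ordersBV -> work (fun l => veval (force multBV l) z) X o = total_work multBV z X.
Proof.
assert (E0 : forall l, force multBV l = ([], []) -> dot (veval (force multBV l) z) (X l) = 0).
  intros l ->; unfold dot, veval; simpl; field; rewrite force_unit_eq; lra.
assert (EQ := E0 LQ3 eq_refl); assert (EZ := E0 LZ1 eq_refl); clear E0.
unfold total_work; intros H; simpl in H.
repeat destruct H as [<-|H]; [..|contradiction]; cbn [work]; lra.
Qed.

Lemma work_VB (z : R) (X : label -> pt) (o : list label) :
  In o ordersVB -> work (fun l => veval (force multVB l) z) X o = total_work multVB z X.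
Proof.
unfold total_work; intros H; simpl in H.
repeat destruct H as [<-|H]; [..|contradiction]; cbn [work]; lra.
Qed.

Lemma orders_taut :
  (affords_bound multBV && forallb (taut (force multBV) ([], [])) ordersBV &&
   (affords_bound multVB && forallb (taut (force multVB) ([], [])) ordersVB))%bool = true.
Proof. vm_compute; reflexivity. Qed.

Theorem theorem6p1 :
  forall (N : nat) (gamma : path) (g : pt -> pt) (h : R) (w : list pt)
    (thetaR tR : R) (mk : label -> pt) (ord : list label),
  let delta := map g gamma in
  escape_minimizer N gamma ->
  standard gamma ->
  ~ convex_path gamma ->
  rigid g ->
  selected_gap delta (mk LF) (mk LM) (mk LT) h ->
  clockwise_boundary delta (mk LF) (mk LT) w ->
  right_delimiter_gap delta w (mk LM) (mk LZ1) (mk LU) (mk LV) thetaR ->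
  tR = tan (thetaR / 2) ->
  - tstar <= tR <= tstar ->
  marked_contacts delta w thetaR tR mk ->
  genuine_right_failure delta mk ->
  ~ genuine_left_failure delta mk ->
  before delta (mk LF) (mk LU) ->
  before delta (mk LU) (mk LT) ->
  before delta (mk LT) (mk LV) ->
  compatible_weak_deque_order delta mk ord ->
  len gamma >= Rbound /\ Rbound > Dbound.
Proof.
intros N gamma g h w thetaR t mk ord delta [Hesc _] [[Hnd _] _] _ Hg Hgap _ Hdel Ht
  Htstar [Hmk _] _ _ HFU _ _ (Hp & Hw & Hi & Hf).
split; [|unfold Rbound, Dbound; lra].
destruct Hgap as (_ & _ & _ & _ & HF & HT & _).
destruct Hdel as (_ & _ & _ & _ & _ & Hth).
assert (Hlen : (2 <= length delta)%nat).
  destruct HFU as (i & j & Hij & _ & Hj).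
  assert (j < length delta)%nat by (apply nth_error_Some; congruence); lia.
assert (HX : forall l y, In y delta ->
    dot y (direction thetaR t l) <= dot (mk l) (direction thetaR t l)).
  intros l y Hy; apply (proj2 (Hmk l)), vertex_in_hull; assumption.
destruct (marked_support_inequalities gamma g thetaR t mk Hesc Hg Hth Ht HF HX)
  as (H3 & H4 & H7).
assert (HUV : dot (dirN t) (mk LU) = dot (dirN t) (mk LV)).
  assert (E : dot (mk LU) (normR thetaR) = dot (mk LV) (normR thetaR)).
    apply Rle_antisym.
    - apply (proj2 (Hmk LV)); exact (proj1 (proj1 (Hmk LU))).
    - apply (proj2 (Hmk LU)); exact (proj1 (proj1 (Hmk LV))).
  destruct (half_angle thetaR t Hth Ht) as [EC ES], cos_sin_beta as [Ec Es].
  assert (HS : 0 < sqrt SS) by (assert (H := sqrt_SS_ge); lra).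
  assert (Hd : 0 < 1 + t ^ 2) by (assert (H := pow2_ge_0 t); lra).
  assert (EN : forall x, dot (dirN t) x = (1 + t ^ 2) * sqrt SS * dot x (normR thetaR)).
    intros x; unfold dot, normR, uvec, dirN; simpl.
    rewrite cos_plus, sin_plus, Ec, Es, EC, ES.
    unfold cb, sb, CR, SR, pp, qq; field; lra.
  now rewrite !EN, E.
assert (Hz : - IZR zmax <= 10 ^ 5 * t <= IZR zmax)
  by (assert (H := tstar_le); unfold zmax; lra).
destruct (deque_orders ord Hp Hf Hi) as (o & Ho & Hsorted).
assert (Hlen_o : len (map mk o) <= len gamma).
  rewrite <- (len_rigid g gamma Hg); apply len_through.
    now apply NoDup_rigid.
  clear Ho; induction Hsorted as [|a o _ IH Hhd]; constructor; [assumption|].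
  destruct Hhd as [|b o Hab]; constructor.
  assert (Hin : forall l, In l ord) by (intros l; apply (Permutation_in l Hp), fan_all).
  exact (ForallOrdPairs_nth _ ord _ _ a b Hw Hab
           (nth_visit_rank _ _ (Hin a)) (nth_visit_rank _ _ (Hin b))).
assert (V := orders_taut); apply andb_prop in V; destruct V as [V1 V2].
apply andb_prop in V1; apply andb_prop in V2.
assert (conclude : forall m, affords_bound m = true -> taut (force m) ([], []) o = true ->
    work (fun l => veval (force m l) (10 ^ 5 * t)) mk o = total_work m (10 ^ 5 * t) mk ->
    len gamma >= Rbound).
  intros m Hworth Htaut Hwork.
  assert (K1 := taut_le_len _ _ _ _ mk Htaut Hz).
  assert (K2 := total_work_ge m t mk Hworth Hz HF HT HUV H3 H4 H7).
  rewrite Hwork in K1; unfold dot at 1, veval at 1 2 in K1; cbn [fst snd peval] in K1.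
  unfold Rdiv in K1; lra.
destruct Ho as [Ho|Ho].
- apply (conclude multBV); [apply V1| |now apply work_BV].
  exact (proj1 (forallb_forall _ _) (proj2 V1) o Ho).
- apply (conclude multVB); [apply V2| |now apply work_VB].
  exact (proj1 (forallb_forall _ _) (proj2 V2) o Ho).
Qed.
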